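(* Let $G$ be an arbitrary (possibly infinite) group, let $S$ be a ring which is epsilon-strongly graded by $G$, and put $R = S_e$. Then the ring extension $S/R$ is separable if and only if $1 \in \mathrm{tr}_{\gamma}(Z(R)_{\rm fin})$.
   Context: Rings are associative with a nonzero multiplicative identity $1$. $Z(R)$ denotes the center of $R$. For a ring $S$ and additive subgroups $X,Y \subseteq S$, $XY$ denotes the set of finite sums of products $xy$ with $x\in X$, $y \in Y$. Let $G$ be a group with identity $e$. Grading: $S$ is graded by $G$ if there are additive subgroups $S_g \subseteq S$ ($g\in G$) with $S = \bigoplus_{g\in G} S_g$ and $S_gS_h \subseteq S_{gh}$ for all $g,h \in G$. The subring $R = S_e$ is the principal component. An ideal of $R$ is called unital if it has its own multiplicative identity element (which is allowed to be $0$). Epsilon-strong grading: a $G$-graded ring $S$ is epsilon-strongly graded by $G$ if for each $g \in G$, $S_gS_{g^{-1}}$ is a unital ideal of $R$, and for all $g,h\in G$ the equalities $S_gS_h = S_gS_{g^{-1}}S_{gh} = S_{gh}S_{h^{-1}}S_h$ hold. In that case $\epsilon_g$ denotes the multiplicative identity element of $S_gS_{g^{-1}}$. Separability: if $R$ is a subring of $S$ containing $1$, then $S/R$ is separable if there is $x\in S\otimes_R S$ with $m(x)=1$, where $m: S\otimes_R S\to S$ is the multiplication map, and $sx = xs$ for every $s \in S$. The maps $\gamma_g$: for each $g\in G$ fix $n_g \in \{1,2,\ldots\}$ and elements $u_g^{(i)} \in S_g$, $v_{g^{-1}}^{(i)} \in S_{g^{-1}}$, $1\le i\le n_g$, with $\sum_{i=1}^{n_g}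 u_g^{(i)} v_{g^{-1}}^{(i)} = \epsilon_g$ (with $n_e=1$ and $u_e^{(1)}=v_e^{(1)}=1$). Define $\gamma_g : S\to S$ by $\gamma_g(s) = \sum_{i=1}^{n_g} u_g^{(i)} s v_{g^{-1}}^{(i)}$. (On $Z(R)$ the map $\gamma_g$ does not depend on the choices and takes values in $Z(R)$.) Trace: $Z(R)_{\rm fin}$ is the set of $r\in Z(R)$ such that $r\epsilon_g = 0$ for all but finitely many $g\in G$. The trace function $\mathrm{tr}_\gamma : Z(R)_{\rm fin}\to Z(R)$ is $\mathrm{tr}_\gamma(r) = \sum_{g\in G}\gamma_g(r)$ (a finite sum for $r\in Z(R)_{\rm fin}$). *)

(* Defs.v *)
From HB Require Import structures.
From mathcomp Require Import all_boot all_algebra ring_quotient.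
From mathcomp Require Import finmap boolp classical_sets functions cardinality.
From mathcomp Require Import fsbigop.
From mathcomp.multinomials Require Import freeg.

Set Implicit Arguments.
Unset Strict Implicit.
Unset Printing Implicit Defensive.

Import GRing.Theory.

Local Open Scope classical_set_scope.
Local Open Scope quotient_scope.
Local Open Scope ring_scope.

Definition additive_subgroup (V : zmodType) (A : set V) : Prop :=
  A 0 /\ (forall x y, A x -> A y -> A (x - y)).

Section Tensor.
Variables (S : nzRingType) (R : set S).

(* S (x)_R S is the free abelian group on S * S modulo the subgroup generated
   by the elements below.  All the definitions make sense for an arbitrary
   subset R, but are only meant to be used for subrings of S. *)
Local Notation free := {freeg (S * S)%type / int}.

Definition tensor_relations : set free :=
  [set z | [\/ exists a a' b : S, z = << (a + a', b) >> - << (a, b) >> - << (a', b) >>,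
               exists a b b' : S, z = << (a, b + b') >> - << (a, b) >> - << (a, b') >>
             | exists a r b : S, R r /\ z = << (a * r, b) >> - << (a, r * b) >>]].

Definition tensor_null : {pred free} :=
  fun z => `[< smallest (@additive_subgroup free) tensor_relations z >].

Fact tensor_null_zmod_closed : zmod_closed tensor_null.
Proof.
split=> [|x y]; first by apply/asboolP => A [[A0 _] _].
rewrite !unfold_in => /asboolP nx /asboolP ny; apply/asboolP => A hA.
by case: (hA) => -[_ AB] _; apply: AB; [exact: nx|exact: ny].
Qed.

HB.instance Definition _ :=
  GRing.isZmodClosed.Build free tensor_null tensor_null_zmod_closed.

Definition tensor : zmodType := Quotient.quot (tensor_null : zmodClosed free).

Definition tens (a b : S) : tensor := \pi_(Quotient.quot tensor_null) << (a, b) >>.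

(* The additive map with a (x) b |-> f a b.  It is computed on an arbitrary
   representative, which is legitimate when f is biadditive and R-balanced
   (see tensor_liftE and tensor_liftD below). *)
Definition tensor_lift (V : zmodType) (f : S -> S -> V) (x : tensor) : V :=
  fglift (fun p => f p.1 p.2 : zmodule V)
    (repr (x : Quotient.quot tensor_null)).

Definition tensor_mul : tensor -> S := tensor_lift *%R.
Definition tensor_lact (s : S) : tensor -> tensor :=
  tensor_lift (fun a b => tens (s * a) b).
Definition tensor_ract (s : S) : tensor -> tensor :=
  tensor_lift (fun a b => tens a (b * s)).

Definition separable_extension : Prop :=
  exists x : tensor, tensor_mul x = 1 /\
    (forall s : S, tensor_lact s x = tensor_ract s x).

Definition balanced_biadditive (V : zmodType) (f : S -> S -> V) : Prop :=
  [/\ forall a a' b, f (a + a') b = f a b + f a' b,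
      forall a b b', f a (b + b') = f a b + f a b'
    & forall a r b, R r -> f (a * r) b = f a (r * b)].

Lemma tensor_pi_eq (x y : free) :
  tensor_null (x - y) ->
  \pi_(Quotient.quot tensor_null) x = \pi_(Quotient.quot tensor_null) y.
Proof. by move=> h; apply/eqP; rewrite -Quotient.idealrBE. Qed.

Lemma tensor_relation_null z : tensor_relations z -> tensor_null z.
Proof. by move=> hz; apply/asboolP => A [_ hA]; exact: hA. Qed.

Lemma tens_balanced_biadditive : balanced_biadditive tens.
Proof.
split=> [a a' b|a b b'|a r b Rr].
- rewrite /tens -[RHS](raddfD (\pi_(Quotient.quot tensor_null))).
  apply: tensor_pi_eq; apply: tensor_relation_null; constructor 1.
  by exists a, a', b; rewrite opprD addrA.
- rewrite /tens -[RHS](raddfD (\pi_(Quotient.quot tensor_null))).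
  apply: tensor_pi_eq; apply: tensor_relation_null; constructor 2.
  by exists a, b, b'; rewrite opprD addrA.
- apply: tensor_pi_eq; apply: tensor_relation_null; constructor 3.
  by exists a, r, b.
Qed.

Lemma fgliftB (V : zmodType) (f : S * S -> V) (x y : free) :
  fglift (f : _ -> zmodule V) (x - y) =
  fglift (f : _ -> zmodule V) x - fglift (f : _ -> zmodule V) y.
Proof. exact: lift_is_additive. Qed.

Lemma tensor_lift_null (V : zmodType) (f : S -> S -> V) (z : free) :
  balanced_biadditive f -> tensor_null z ->
  fglift (fun p => f p.1 p.2 : zmodule V) z = 0.
Proof.
move=> [fDl fDr fb] /asboolP nz.
apply: (nz [set w | fglift (fun p => f p.1 p.2 : zmodule V) w = 0]).
split; first split=> /=.
- by rewrite -(subrr (0 : free)) fgliftB subrr.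
- by move=> x y x0 y0; rewrite fgliftB x0 y0 subrr.
- move=> _ [[a [a' [b ->]]]|[a [b [b' ->]]]|[a [r [b [Rr ->]]]]] /=;
    rewrite !fgliftB !liftU !scale1r /=.
  + by rewrite fDl addrAC addrK subrr.
  + by rewrite fDr addrAC addrK subrr.
  + by rewrite fb ?subrr.
Qed.

Lemma tensor_lift_pi (V : zmodType) (f : S -> S -> V) (z : free) :
  balanced_biadditive f ->
  tensor_lift f (\pi_(Quotient.quot tensor_null) z) =
  fglift (fun p => f p.1 p.2 : zmodule V) z.
Proof.
move=> fP; apply/eqP; rewrite -subr_eq0 -fgliftB; apply/eqP.
apply: tensor_lift_null => //.
have := Quotient.idealrBE (tensor_null : zmodClosed free)
  (repr (\pi_(Quotient.quot tensor_null) z)) z.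
by rewrite reprK eqxx.
Qed.

Lemma tensor_liftE (V : zmodType) (f : S -> S -> V) (a b : S) :
  balanced_biadditive f -> tensor_lift f (tens a b) = f a b.
Proof. by move=> fP; rewrite tensor_lift_pi // liftU scale1r. Qed.

Lemma tensor_liftD (V : zmodType) (f : S -> S -> V) :
  balanced_biadditive f -> {morph tensor_lift f : x y / x + y}.
Proof.
move=> fP x y.
rewrite -[x](@reprK _ (Quotient.quot tensor_null)).
rewrite -[y](@reprK _ (Quotient.quot tensor_null)).
rewrite -(raddfD (\pi_(Quotient.quot tensor_null))) !tensor_lift_pi //.
have fgN (w : free) : fglift (fun p => f p.1 p.2 : zmodule V) (- w) =
    - fglift (fun p => f p.1 p.2 : zmodule V) w.
  rewrite -[- w]add0r fgliftB -(subrr (0 : free)) fgliftB subrr.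
  exact: sub0r.
rewrite -[in LHS](opprK (repr y)) fgliftB fgN.
by rewrite opprK.
Qed.

Lemma tensor_mulE (a b : S) : tensor_mul (tens a b) = a * b.
Proof.
apply: tensor_liftE; split=> *; [exact: mulrDl|exact: mulrDr|].
by rewrite mulrA.
Qed.

Lemma tensor_lactE (s a b : S) : tensor_lact s (tens a b) = tens (s * a) b.
Proof.
have [tDl tDr tb] := tens_balanced_biadditive.
apply: (tensor_liftE (f := fun a b => tens (s * a) b)).
by split=> *; rewrite ?mulrDr ?tDl ?tDr // mulrA tb.
Qed.

Lemma tensor_ractE (s a b : S) : tensor_ract s (tens a b) = tens a (b * s).
Proof.
have [tDl tDr tb] := tens_balanced_biadditive.
apply: (tensor_liftE (f := fun a b => tens a (b * s))).
by split=> *; rewrite ?mulrDl ?tDl ?tDr // tb // mulrA.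
Qed.

End Tensor.

Section Graded.
Variables (G : groupType) (S : nzRingType) (S_ : G -> set S).

Definition set_prod (X Y : set S) : set S :=
  [set z | exists (k : nat) (x y : 'I_k -> S),
     [/\ forall i, X (x i), forall i, Y (y i) & z = \sum_(i < k) x i * y i]].

Definition graded : Prop :=
  [/\ forall g, additive_subgroup (S_ g),
      forall s : S, exists! c : G -> S,
        [/\ forall g, S_ g (c g), finite_set [set g | c g <> 0]
          & s = \sum_(g \in [set: G]) c g]
    & forall g h, set_prod (S_ g) (S_ h) `<=` S_ (g * h)%g].

Definition principal : set S := S_ 1%g.

Definition is_identity (I : set S) (e : S) : Prop :=
  I e /\ (forall x, I x -> e * x = x /\ x * e = x).

Definition ideal_of (R I : set S) : Prop :=
  [/\ I `<=` R, additive_subgroup I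
    & forall r x, R r -> I x -> I (r * x) /\ I (x * r)].

Definition unital_ideal (R I : set S) : Prop :=
  ideal_of R I /\ exists e, is_identity I e.

Definition epsilon_strongly_graded : Prop :=
  [/\ graded,
      forall g, unital_ideal principal (set_prod (S_ g) (S_ g^-1%g))
    & forall g h,
        set_prod (S_ g) (S_ h) =
          set_prod (set_prod (S_ g) (S_ g^-1%g)) (S_ (g * h)%g) /\
        set_prod (S_ g) (S_ h) =
          set_prod (set_prod (S_ (g * h)%g) (S_ h^-1%g)) (S_ h)].

(* The identity element is unique when it exists; 0 is a junk value. *)
Definition epsilon (g : G) : S :=
  xget 0 (is_identity (set_prod (S_ g) (S_ g^-1%g))).

Lemma epsilonP (g : G) : epsilon_strongly_graded ->
  is_identity (set_prod (S_ g) (S_ g^-1%g)) (epsilon g).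
Proof. by move=> [_ /(_ g)[_ [e eP]] _]; exact: xgetPex (ex_intro _ e eP). Qed.

Definition center_of (R : set S) : set S :=
  [set r | R r /\ (forall t, R t -> r * t = t * r)].

Definition center_fin : set S :=
  [set r | center_of principal r /\ finite_set [set g | r * epsilon g <> 0]].

Section Gamma.
Variables (n : G -> nat) (u v : forall g, 'I_(n g) -> S).

(* v g i stands for the element v_{g^-1}^(i) of S_{g^-1}, which is indexed by
   i <= n_g: it is the partner of u g i in the decomposition of epsilon_g. *)
Definition epsilon_decomposition : Prop :=
  [/\ forall g, (0 < n g)%N,
      forall g i, S_ g (u i : S) /\ S_ g^-1%g (@v g i),
      forall g, \sum_(i < n g) @u g i * @v g i = epsilon g,
      n 1%g = 1%N
    & forall i : 'I_(n 1%g), @u 1%g i = 1 /\ @v 1%g i = 1].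

Definition gamma (g : G) (s : S) : S := \sum_(i < n g) @u g i * s * @v g i.

(* Finite sum: gamma g r = 0 as soon as r * epsilon g^-1 = 0, so r in center_fin
   ensures finite support.  For r outside center_fin the value is irrelevant. *)
Definition trace_gamma (r : S) : S := \sum_(g \in [set: G]) gamma g r.

End Gamma.
End Graded.

(* Main.v *)
Require Import Defs.
From mathcomp Require Import all_boot all_algebra classical_sets.
From mathcomp Require Import boolp cardinality fsbigop.
From mathcomp.multinomials Require Import freeg.

(** Write [R] for the principal component, and [eps_g] for the identity of the
    ideal [S_g S_{g^-1}].  The grading axioms say that [eps_g] is a left
    identity on [S_g] and a right identity on [S_{g^-1}] ([epsilon_mull],
    [epsilon_mulr]), which makes the elements [u_g^(i)], [v_{g^-1}^(i)] behave
    like dual bases.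

    Suppose that [r] is central in [R], that [r eps_g] vanishes for almost all
    [g], and that [r] has trace 1.  Then
    [x = sum_g sum_i u_g^(i) r (x) v_{g^-1}^(i)] is a finite sum, and the
    multiplication sends it to the trace of [r], that is, to 1.  It commutes
    with a homogeneous [s] of degree [h] because left multiplication by [s]
    carries the term of degree [g] to the term of degree [hg] multiplied by [s]
    on the right: the dual bases let the coefficients, which lie in [R], slide
    across the tensor sign ([trace_tensor_comm]).

    Conversely, let [x] be a separability element and let [f_g (x)] be the image
    of [x] under [a (x) b |-> a_g b_{g^-1}].  Comparing degrees in [s x = x s]
    gives [s f_g (x) = f_{hg} (x) s] for every [s] of degree [h]
    ([diagonal_part_comm]).  Put [r = f_1 (x)].  The case [h = 1] shows that [r]
    is central in [R], and [g = 1] gives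
    [gamma_h (r) = sum_i f_h (x) u_h^(i) v_{h^-1}^(i) = f_h (x)].  So the trace
    of [r] is the sum of all [f_g (x)], which is the component of degree 1 of
    [m (x) = 1].  Almost all [f_g (x)] vanish, and [r eps_g] vanishes together
    with [f_{g^-1} (x)]. *)

Set Implicit Arguments.
Unset Strict Implicit.
Unset Printing Implicit Defensive.

Import GRing.Theory.

Local Open Scope classical_set_scope.
Local Open Scope quotient_scope.
Local Open Scope ring_scope.

(** * Finitely supported sums *)

Section FiniteSums.
Variable I : choiceType.
Implicit Types V W : zmodType.

Lemma fsum_seq V (F : I -> V) (D : seq I) : uniq D ->
  (forall i, i \notin D -> F i = 0) -> \sum_(i \in [set: I]) F i = \sum_(i <- D) F i.
Proof.
move=> uD F0; rewrite (@bigfs _ _ _ _ D xpredT) // => [|i _ iD]; last exact: F0.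
by apply: eq_fsbigl; apply/seteqP; split.
Qed.

Lemma finite_supp_seq V (F : I -> V) : finite_set [set i | F i <> 0] ->
  exists2 D : seq I, uniq D & forall i, i \notin D -> F i = 0.
Proof.
move=> /finite_seqP[D eD]; exists (undup D); first exact: undup_uniq.
move=> i; rewrite mem_undup; apply: contraNeq => /eqP Fi.
by have : [set i | F i <> 0] i by []; rewrite eD.
Qed.

Lemma additive0 V W (f : V -> W) : {morph f : x y / x + y} -> f 0 = 0.
Proof. by move=> fD; apply: (addrI (f 0)); rewrite -fD !addr0. Qed.

Lemma additive_sum V W (f : V -> W) : {morph f : x y / x + y} ->
  forall (J : Type) (s : seq J) (F : J -> V),
    f (\sum_(j <- s) F j) = \sum_(j <- s) f (F j).
Proof. by move=> fD J s F; apply: big_morph => //; exact: additive0. Qed.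

Lemma additive_fsum V W (f : V -> W) (F : I -> V) : {morph f : x y / x + y} ->
  finite_set [set i | F i <> 0] ->
  f (\sum_(i \in [set: I]) F i) = \sum_(i \in [set: I]) f (F i).
Proof.
move=> fD /finite_supp_seq[D uD D0]; rewrite (fsum_seq uD D0) additive_sum //.
by rewrite (fsum_seq uD) // => i /D0 ->; exact: additive0.
Qed.

Lemma finite_suppD V (F H : I -> V) :
  finite_set [set i | F i <> 0] -> finite_set [set i | H i <> 0] ->
  finite_set [set i | F i + H i <> 0].
Proof.
move=> fF fH; apply: (@sub_finite_set _ _ ([set i | F i <> 0] `|` [set i | H i <> 0])).
  move=> i /= FHi; apply: contrapT => /not_orP[/contrapT Fi /contrapT Hi].
  by apply: FHi; rewrite Fi Hi addr0.
by rewrite finite_setU.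
Qed.

Lemma fsumD V (F H : I -> V) :
  finite_set [set i | F i <> 0] -> finite_set [set i | H i <> 0] ->
  \sum_(i \in [set: I]) (F i + H i) =
  \sum_(i \in [set: I]) F i + \sum_(i \in [set: I]) H i.
Proof.
move=> /finite_supp_seq[D uD D0] /finite_supp_seq[E uE E0].
have U0 K : (forall i : I, i \notin D -> K i = 0 :> V) \/
            (forall i, i \notin E -> K i = 0) ->
    forall i, i \notin undup (D ++ E) -> K i = 0.
  move=> K0 i; rewrite mem_undup mem_cat negb_or => /andP[iD iE].
  by case: K0 => K0; apply: K0.
rewrite !(fsum_seq (undup_uniq (D ++ E))); first by rewrite big_split.
- by apply: U0; right.
- by apply: U0; left.
- move=> i; rewrite mem_undup mem_cat negb_or => /andP[/D0 -> /E0 ->].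
  exact: addr0.
Qed.

End FiniteSums.

(** * The tensor square *)

Section TensorSquare.
Variables (S : nzRingType) (R : set S).
Local Notation tensor := (tensor R).
Local Notation tens := (@tens S R).
Local Notation free := {freeg (S * S)%type / int}.

Lemma tens0l b : tens 0 b = 0.
Proof.
by have [tDl _ _] := tens_balanced_biadditive R; apply: (addrI (tens 0 b));
  rewrite -tDl !addr0.
Qed.

Lemma tensNl a b : tens (- a) b = - tens a b.
Proof.
have [tDl _ _] := tens_balanced_biadditive R.
by apply: (addrI (tens a b)); rewrite -tDl !subrr tens0l.
Qed.

Lemma tens_suml (J : Type) (s : seq J) (F : J -> S) b :
  tens (\sum_(j <- s) F j) b = \sum_(j <- s) tens (F j) b.
Proof.
have [tDl _ _] := tens_balanced_biadditive R.
by apply: (additive_sum (f := fun a => tens a b)) => a a'; exact: tDl.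
Qed.

Lemma tens_sumr (J : Type) (s : seq J) (F : J -> S) a :
  tens a (\sum_(j <- s) F j) = \sum_(j <- s) tens a (F j).
Proof.
have [_ tDr _] := tens_balanced_biadditive R.
by apply: (additive_sum (f := tens a)) => b b'; exact: tDr.
Qed.

(** No closure under opposites is asked for: [- (a (x) b)] is again a pure
    tensor, so the pure tensors generate the tensor square as a monoid. *)
Lemma tensor_ind (P : tensor -> Prop) :
  P 0 -> (forall x y, P x -> P y -> P (x + y)) -> (forall a b, P (tens a b)) ->
  forall x, P x.
Proof.
move=> P0 PD Pt x.
pose pi (z : free) : tensor := \pi_(Quotient.quot (tensor_null R)) z.
have piD : {morph pi : y z / y + z} by move=> y z; exact: raddfD.
have piN y : pi (- y) = - pi y by exact: raddfN.
rewrite -[x](@reprK _ (Quotient.quot (tensor_null R))) -/(pi _).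
move: (repr _) => z; have -> : z = \sum_(p <- dom z) << coeff p z *g p >>.
  apply/eqP/freeg_eqP => q; rewrite raddf_sum /=.
  have [qz|qz] := boolP (q \in dom z).
    rewrite (bigD1_seq q) ?uniq_dom //= coeffU eqxx mulr1 big1 ?addr0 // => p pq.
    by rewrite coeffU (negPf pq) mulr0.
  rewrite coeff_outdom // big1_seq // => p /andP[_ pz].
  by rewrite coeffU; case: eqVneq pz qz => [->->//|_ _ _]; rewrite mulr0.
rewrite additive_sum //; apply: big_ind => // p _; move: (coeff _ _) => k.
have natP m : P (pi << m%:Z *g p >>) /\ P (- pi << m%:Z *g p >>).
  elim: m => [|m [IH1 IH2]].
    suff -> : << 0%:Z *g p >> = 0 :> free by rewrite (additive0 piD) oppr0.
    by apply/eqP/freeg_eqP => q; rewrite coeffU coeff0 mul0r.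
  have -> : << m.+1%:Z *g p >> = << m%:Z *g p >> + << p >> :> free.
    apply/eqP/freeg_eqP => q; rewrite coeffD !coeffU mul1r -addn1 PoszD mulrDl.
    by rewrite mul1r.
  have -> : pi (<< m%:Z *g p >> + << p >>) =
      pi << m%:Z *g p >> + tens p.1 p.2 by rewrite piD; case: (p).
  by split; [exact: PD|rewrite opprD -tensNl; exact: PD].
case: k => m; first exact: (natP m).1.
suff -> : << Negz m *g p >> = - << m.+1%:Z *g p >> :> free.
  by rewrite piN; exact: (natP m.+1).2.
by apply/eqP/freeg_eqP => q; rewrite coeffN !coeffU NegzE mulNr.
Qed.

Lemma tensor_mulD : {morph @tensor_mul S R : x y / x + y}.
Proof.
apply: tensor_liftD; split=> *; [exact: mulrDl|exact: mulrDr|].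
by rewrite mulrA.
Qed.

Lemma tensor_lactD s : {morph @tensor_lact S R s : x y / x + y}.
Proof.
have [tDl tDr tb] := tens_balanced_biadditive R.
apply: tensor_liftD.
by split=> *; rewrite ?mulrDr ?tDl ?tDr // mulrA tb.
Qed.

Lemma tensor_ractD s : {morph @tensor_ract S R s : x y / x + y}.
Proof.
have [tDl tDr tb] := tens_balanced_biadditive R.
apply: tensor_liftD.
by split=> *; rewrite ?mulrDl ?tDl ?tDr // tb // mulrA.
Qed.

Lemma tensor_lactDs s t (x : tensor) :
  tensor_lact (s + t) x = tensor_lact s x + tensor_lact t x.
Proof.
have [tDl _ _] := tens_balanced_biadditive R.
elim/tensor_ind: x => [|x y hx hy|a b].
- by rewrite !(additive0 (@tensor_lactD _)) addr0.
- by rewrite !tensor_lactD hx hy addrACA.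
- by rewrite !tensor_lactE mulrDl tDl.
Qed.

Lemma tensor_ractDs s t (x : tensor) :
  tensor_ract (s + t) x = tensor_ract s x + tensor_ract t x.
Proof.
have [_ tDr _] := tens_balanced_biadditive R.
elim/tensor_ind: x => [|x y hx hy|a b].
- by rewrite !(additive0 (@tensor_ractD _)) addr0.
- by rewrite !tensor_ractD hx hy addrACA.
- by rewrite !tensor_ractE mulrDr tDr.
Qed.

End TensorSquare.

(** * Homogeneous components *)

Lemma set_prod_ind (S : nzRingType) (X Y : set S) (P : S -> Prop) :
  P 0 -> (forall a b, P a -> P b -> P (a + b)) ->
  (forall a b, X a -> Y b -> P (a * b)) -> forall z, set_prod X Y z -> P z.
Proof.
move=> P0 PD PM z [k [a [b [Xa Yb ->]]]].
by apply: big_ind => // i _; exact: PM.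
Qed.

Lemma set_prodM (S : nzRingType) (X Y : set S) a b :
  X a -> Y b -> set_prod X Y (a * b).
Proof.
by move=> Xa Yb; exists 1%N, (fun=> a), (fun=> b); split; rewrite ?big_ord1.
Qed.

Section Components.
Variables (G : groupType) (S : nzRingType) (S_ : G -> set S).
Hypothesis grS : graded S_.

Lemma grade0 g : S_ g 0.
Proof. by have [/(_ g)[]] := grS. Qed.

Lemma gradeD g a b : S_ g a -> S_ g b -> S_ g (a + b).
Proof.
move=> Sa Sb; have [/(_ g)[S0 SB] _ _] := grS.
by rewrite -[b]opprK; apply: (SB) => //; rewrite -sub0r; exact: SB.
Qed.

Lemma gradeM g h a b : S_ g a -> S_ h b -> S_ (g * h)%g (a * b).
Proof.
by move=> Sa Sb; have [_ _ SM] := grS; apply: SM; exact: set_prodM.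
Qed.

Lemma part_exists (s : S) : exists c : G -> S,
  [/\ forall g, S_ g (c g), finite_set [set g | c g <> 0]
    & s = \sum_(g \in [set: G]) c g].
Proof. by have [_ /(_ s)[c [cP _]] _] := grS; exists c. Qed.

Definition part (g : G) (s : S) : S := sval (cid (part_exists s)) g.

Lemma part_grade g s : S_ g (part g s).
Proof. by rewrite /part; case: cid => c [] /=. Qed.

Lemma part_finite s : finite_set [set g | part g s <> 0].
Proof. by rewrite /part; case: cid => c []. Qed.

Lemma part_sum s : s = \sum_(g \in [set: G]) part g s.
Proof. by rewrite /part; case: cid => c []. Qed.

Lemma part_unique s (c : G -> S) : (forall g, S_ g (c g)) ->
  finite_set [set g | c g <> 0] -> s = \sum_(g \in [set: G]) c g ->
  forall g, part g s = c g.
Proof.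
move=> Sc fc sc g; have [_ /(_ s)[d [_ dU]] _] := grS.
rewrite -(dU c) //; suff -> : d = part^~ s by [].
by apply: dU; split; [move=> k; exact: part_grade|exact: part_finite|exact: part_sum].
Qed.

Lemma partD g : {morph part g : s t / s + t}.
Proof.
move=> s t; apply: (part_unique (c := fun k => part k s + part k t)).
- by move=> k; apply: gradeD; exact: part_grade.
- by apply: finite_suppD; exact: part_finite.
- by rewrite fsumD -?part_sum //; exact: part_finite.
Qed.

Lemma part_homogeneous h s g : S_ h s -> part g s = if g == h then s else 0.
Proof.
move=> Ss; apply: (part_unique (c := fun k => if k == h then s else 0)).
- by move=> k; case: eqP => [->|_] //; exact: grade0.
- apply: (@sub_finite_set _ _ [set h]); last exact: finite_set1.
  by move=> k /=; case: eqP.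
- rewrite (@fsum_seq _ _ _ [:: h]) //; first by rewrite big_seq1 eqxx.
  by move=> k; rewrite inE => /negPf ->.
Qed.

Lemma homogeneous_ind (P : S -> Prop) : P 0 ->
  (forall s t, P s -> P t -> P (s + t)) -> (forall g s, S_ g s -> P s) ->
  forall s, P s.
Proof.
move=> P0 PD PS s; have [D uD D0] := finite_supp_seq (part_finite s).
rewrite [s]part_sum (fsum_seq uD D0).
by apply: big_ind => // g _; apply: (PS g); exact: part_grade.
Qed.

Lemma partMl h s g a : S_ h s -> part (h * g)%g (s * a) = s * part g a.
Proof.
move=> Ss; elim/homogeneous_ind: a => [|a b IHa IHb|k a Sa].
- by rewrite mulr0 !(additive0 (@partD _)) mulr0.
- by rewrite mulrDr !partD mulrDr IHa IHb.
- rewrite (part_homogeneous _ (gradeM Ss Sa)) (part_homogeneous _ Sa).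
  by rewrite (inj_eq (mulgI h)); case: eqP; rewrite ?mulr0.
Qed.

Lemma partMr h s g a : S_ h s -> part (g * h)%g (a * s) = part g a * s.
Proof.
move=> Ss; elim/homogeneous_ind: a => [|a b IHa IHb|k a Sa].
- by rewrite mul0r !(additive0 (@partD _)) mul0r.
- by rewrite mulrDl !partD mulrDl IHa IHb.
- rewrite (part_homogeneous _ (gradeM Sa Ss)) (part_homogeneous _ Sa).
  by rewrite (inj_eq (mulIg h)); case: eqP; rewrite ?mul0r.
Qed.

(** For [g <> 1] the component [1_g] annihilates every homogeneous element on
    the right, since [s 1_g] is the component of degree [hg] of [s = s 1] when
    [s] has degree [h].  Hence it annihilates [1] and vanishes. *)
Lemma grade1 : S_ 1%g 1.
Proof.
have part1 g : g != 1%g -> part g 1 = 0.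
  move=> g1; rewrite -[LHS]mul1r; move: {1}1.
  apply: homogeneous_ind => [|s t hs ht|h s Ss].
  - exact: mul0r.
  - by rewrite mulrDl hs ht addr0.
  - rewrite -(partMl _ _ Ss) mulr1 (part_homogeneous _ Ss).
    by rewrite -{2}(mulg1 h) (inj_eq (mulgI h)) (negPf g1).
rewrite [1]part_sum (@fsum_seq _ _ _ [:: 1%g]) ?big_seq1 //.
  exact: part_grade.
by move=> g; rewrite inE; exact: part1.
Qed.

Local Notation tensor := (tensor (principal S_)).

(** The component of bidegree [(p, q)], multiplied out. *)
Definition bipart (p q : G) : tensor -> S :=
  tensor_lift (fun a b => part p a * part q b).

Lemma bipart_balanced p q :
  balanced_biadditive (principal S_) (fun a b => part p a * part q b).
Proof.
split=> [a a' b|a b b'|a r b Rr]; first by rewrite partD mulrDl.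
  by rewrite partD mulrDr.
by rewrite -{1}(mulg1 p) -{2}(mul1g q) (partMr _ _ Rr) (partMl _ _ Rr) mulrA.
Qed.

Lemma bipartE p q a b :
  bipart p q (tens (principal S_) a b) = part p a * part q b.
Proof. exact: tensor_liftE (bipart_balanced p q). Qed.

Lemma bipartD p q : {morph bipart p q : x y / x + y}.
Proof. exact: tensor_liftD (bipart_balanced p q). Qed.

Lemma bipart_grade p q x : S_ (p * q)%g (bipart p q x).
Proof.
elim/tensor_ind: x => [|x y hx hy|a b].
- by rewrite (additive0 (@bipartD _ _)); exact: grade0.
- by rewrite bipartD; exact: gradeD.
- by rewrite bipartE; apply: gradeM; exact: part_grade.
Qed.

Lemma bipart_lact h s p q x : S_ h s ->
  bipart (h * p)%g q (tensor_lact s x) = s * bipart p q x.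
Proof.
move=> Ss; elim/tensor_ind: x => [|x y hx hy|a b].
- by rewrite (additive0 (@tensor_lactD _ _ _)) !(additive0 (@bipartD _ _)) mulr0.
- by rewrite tensor_lactD !bipartD mulrDr hx hy.
- by rewrite tensor_lactE !bipartE (partMl _ _ Ss) mulrA.
Qed.

Lemma bipart_ract h s p q x : S_ h s ->
  bipart p (q * h)%g (tensor_ract s x) = bipart p q x * s.
Proof.
move=> Ss; elim/tensor_ind: x => [|x y hx hy|a b].
- by rewrite (additive0 (@tensor_ractD _ _ _)) !(additive0 (@bipartD _ _)) mul0r.
- by rewrite tensor_ractD !bipartD mulrDl hx hy.
- by rewrite tensor_ractE !bipartE (partMr _ _ Ss) mulrA.
Qed.

(** Evaluate the component of bidegree [(hg, g^-1)] on both sides of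
    [s x = x s]. *)
Lemma diagonal_part_comm x h s g :
  (forall t, tensor_lact t x = tensor_ract t x) -> S_ h s ->
  s * bipart g g^-1%g x = bipart (h * g)%g (h * g)^-1%g x * s.
Proof.
move=> xC Ss; rewrite -(bipart_lact _ _ _ Ss) xC -(bipart_ract _ _ _ Ss).
by rewrite invgM mulgVK.
Qed.

(** Only the bidegrees [(g, g^-1)] contribute to the component of degree 1 of a
    product. *)
Lemma diagonal_part_sum x :
  finite_set [set g | bipart g g^-1%g x <> 0] /\
  \sum_(g \in [set: G]) bipart g g^-1%g x = part 1%g (tensor_mul x).
Proof.
elim/tensor_ind: x => [|x y [fx sx] [fy sy]|a b].
- have F0 g : bipart g g^-1%g 0 = 0 by exact: additive0 (@bipartD _ _).
  split; first by apply: (@sub_finite_set _ _ set0) => // g /=; rewrite F0.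
  rewrite (additive0 (@tensor_mulD _ _)) (additive0 (@partD _)).
  by rewrite fsbig1 // => g _; exact: F0.
- under eq_set do rewrite bipartD; under eq_fsbigr do rewrite bipartD.
  by split; [exact: finite_suppD|rewrite fsumD // tensor_mulD partD sx sy].
- under eq_set do rewrite bipartE; under eq_fsbigr do rewrite bipartE.
  split.
    apply: sub_finite_set (part_finite a) => g /= ab0 a0.
    by apply: ab0; rewrite a0 mul0r.
  rewrite tensor_mulE [in RHS](part_sum a).
  have cD : {morph (fun c => part 1%g (c * b)) : c d / c + d}.
    by move=> c d; rewrite mulrDl partD.
  apply: etrans (esym (additive_fsum cD (part_finite a))).
  by apply: eq_fsbigr => g _; rewrite -(partMl _ _ (part_grade g a)) mulgV.
Qed.

End Components.

(** * Local identities and traces *)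

Section EpsilonStrong.
Variables (G : groupType) (S : nzRingType) (S_ : G -> set S).
Hypothesis epsS : epsilon_strongly_graded S_.
Local Notation R := (principal S_).
Local Notation epsilon := (epsilon S_).

Let grS : graded S_. Proof. by case: epsS. Qed.

Lemma epsilon_principal g : R (epsilon g).
Proof.
have [_ /(_ g)[[IR _ _] _] _] := epsS.
by apply: IR; case: (epsilonP g epsS).
Qed.

(** [S_g = S_g S_1 = (S_g S_{g^-1}) S_g], and [eps_g] is the identity of the
    first factor. *)
Lemma epsilon_mull g s : S_ g s -> epsilon g * s = s.
Proof.
move=> Ss; have [_ epsI] := epsilonP g epsS.
have := set_prodM Ss (grade1 grS); rewrite mulr1.
have [_ _ /(_ g 1%g)[-> _]] := epsS.
elim/set_prod_ind=> [|a b ha hb|a b Ia _]; first by rewrite mulr0.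
  by rewrite mulrDr ha hb.
by rewrite mulrA (epsI a Ia).1.
Qed.

(** [S_{g^-1} = S_1 S_{g^-1} = S_{g^-1} (S_g S_{g^-1})], and [eps_g] is the
    identity of the last factor. *)
Lemma epsilon_mulr g s : S_ g^-1%g s -> s * epsilon g = s.
Proof.
move=> Ss; have [_ epsI] := epsilonP g epsS.
have := set_prodM (grade1 grS) Ss; rewrite mul1r.
have [_ _ /(_ 1%g g^-1%g)[_ ->]] := epsS; rewrite mul1g invgK.
elim/set_prod_ind=> [|a b ha hb|a b Ia Sb]; first by rewrite mul0r.
  by rewrite mulrDl ha hb.
elim/set_prod_ind: Ia => [|c d hc hd|c d _ Sd]; first by rewrite !mul0r.
  by rewrite !mulrDl hc hd.
by rewrite -!mulrA [in LHS](mulrA d) (epsI _ (set_prodM Sd Sb)).2.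
Qed.

Variables (n : G -> nat) (u v : forall g : G, 'I_(n g) -> S).
Arguments u : clear implicits.
Arguments v : clear implicits.
Hypothesis uvP : epsilon_decomposition S_ u v.

Let uS g i : S_ g (u g i). Proof. by have [_ /(_ g i)[]] := uvP. Qed.
Let vS g i : S_ g^-1%g (v g i). Proof. by have [_ /(_ g i)[]] := uvP. Qed.
Let uvE g : \sum_(i < n g) u g i * v g i = epsilon g.
Proof. by case: uvP. Qed.

Definition trace_tensor r g : tensor R :=
  \sum_(i < n g) tens R (u g i * r) (v g i).

Lemma trace_tensor_finite r : center_fin S_ r ->
  finite_set [set g | trace_tensor r g <> 0].
Proof.
move=> [[_ rC] fr].
have : finite_set ((fun g : G => g^-1%g) @^-1` [set g | r * epsilon g <> 0]).
  by apply: finite_preimage => // g h _ _; exact: invg_inj.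
apply: sub_finite_set => g /= + reps0; apply.
apply: big1 => i _.
have <- : u g i * epsilon g^-1%g = u g i by apply: epsilon_mulr; rewrite invgK.
rewrite -mulrA -rC; last exact: epsilon_principal.
by rewrite reps0 mulr0 tens0l.
Qed.

Lemma tensor_mul_trace r g : tensor_mul (trace_tensor r g) = gamma u v g r.
Proof.
rewrite /trace_tensor (additive_sum (@tensor_mulD _ _)).
by apply: eq_bigr => i _; rewrite tensor_mulE.
Qed.

(** Expand [s u_g^(i)], of degree [hg], in the dual basis of degree [hg]: the
    coefficients [v_{(hg)^-1}^(j) s u_g^(i)] lie in [R], so they commute with
    [r] and slide across the tensor sign, where they recombine into the
    expansion of [v_{(hg)^-1}^(j) s] in the dual basis of degree [g]. *)
Lemma trace_tensor_comm r h s g : center_of R r -> S_ h s ->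
  tensor_lact s (trace_tensor r g) = tensor_ract s (trace_tensor r (h * g)%g).
Proof.
move=> [Rr rC] Ss; have [_ _ tb] := tens_balanced_biadditive R.
rewrite /trace_tensor !(additive_sum (@tensor_lactD _ _ _)).
rewrite !(additive_sum (@tensor_ractD _ _ _)).
pose w j i := tens R (u (h * g)%g j * r) (v (h * g)%g j * s * u g i * v g i).
transitivity (\sum_(i < n g) \sum_(j < n (h * g)%g) w j i).
  apply: eq_bigr => i _; rewrite tensor_lactE mulrA.
  rewrite -(epsilon_mull (gradeM grS Ss (uS i))) -uvE !mulr_suml tens_suml.
  apply: eq_bigr => j _; rewrite /w.
  have Rc : R (v (h * g)%g j * s * u g i).
    rewrite /principal -(mulVg (h * g)%g) mulgA.
    by apply: (gradeM grS) => //; exact: gradeM.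
  by rewrite -tb // -[in RHS]mulrA rC // !mulrA.
rewrite exchange_big; apply: eq_bigr => j _; rewrite tensor_ractE.
have Svs : S_ g^-1%g (v (h * g)%g j * s).
  by rewrite -[g^-1%g](mulgVK h) -invgM; exact: gradeM.
rewrite -[X in tens _ _ X](epsilon_mulr Svs) -uvE mulr_sumr tens_sumr.
by apply: eq_bigr => i _; rewrite /w !mulrA.
Qed.

Lemma separable_of_trace r :
  center_fin S_ r -> trace_gamma u v r = 1 -> separable_extension R.
Proof.
move=> rf tr1; have [rC _] := rf; have fr := trace_tensor_finite rf.
exists (\sum_(g \in [set: G]) trace_tensor r g); split.
  rewrite (additive_fsum (@tensor_mulD _ _)) // -tr1.
  by apply: eq_fsbigr => g _; exact: tensor_mul_trace.
apply: (homogeneous_ind grS) => [|s t hs ht|h s Ss].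
- have l0 x : tensor_lact 0 x = 0 :> tensor R.
    by apply: (additive0 (f := fun s => tensor_lact s x)) => s t;
      exact: tensor_lactDs.
  have r0 x : tensor_ract 0 x = 0 :> tensor R.
    by apply: (additive0 (f := fun s => tensor_ract s x)) => s t;
      exact: tensor_ractDs.
  by rewrite l0 r0.
- by rewrite tensor_lactDs tensor_ractDs hs ht.
- rewrite !additive_fsum //; [|exact: tensor_ractD|exact: tensor_lactD].
  rewrite [RHS](@reindex_fsbig _ _ _ _ _ (fun g => h * g)%g setT); last first.
    split=> //; first by move=> g k _ _; exact: (mulgI h).
    by move=> k _; exists (h^-1 * k)%g; rewrite // mulVKg.
  by apply: eq_fsbigr => g _; exact: trace_tensor_comm.
Qed.

Lemma trace_of_separable :
  separable_extension R -> (trace_gamma u v @` center_fin S_) 1.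
Proof.
move=> [x [mx1 xC]].
pose f g := bipart grS g g^-1%g x.
have fC h s g : S_ h s -> s * f g = f (h * g)%g * s by exact: diagonal_part_comm.
have [ff sf] := diagonal_part_sum grS x; rewrite -/f in ff sf.
have gammaf g : gamma u v g (f 1%g) = f g.
  transitivity (\sum_(i < n g) f g * (u g i * v g i)).
    by apply: eq_bigr => i _; rewrite (fC g) // mulg1 mulrA.
  rewrite -mulr_sumr uvE.
  (* [f g] is a sum of products whose right factors have degree [g^-1], on
     which [eps_g] acts as a right identity. *)
  rewrite /f; move: (x) => t; elim/tensor_ind: t => [|y z hy hz|a b].
  - by rewrite (additive0 (@bipartD _ _ _ grS _ _)) mul0r.
  - by rewrite bipartD mulrDl hy hz.
  - rewrite bipartE -mulrA epsilon_mulr //; exact: part_grade.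
exists (f 1%g); last first.
  rewrite /trace_gamma; under eq_fsbigr do rewrite gammaf.
  by rewrite sf mx1 (part_homogeneous _ _ (grade1 grS)) eqxx.
split.
  split; first by have := bipart_grade grS 1%g 1%g^-1%g x; rewrite mulgV.
  by move=> t Rt; rewrite (fC 1%g) // mulg1.
have : finite_set ((fun g : G => g^-1%g) @^-1` [set g | f g <> 0]).
  by apply: finite_preimage => // g h _ _; exact: invg_inj.
apply: sub_finite_set => g /= + f0; apply.
rewrite -uvE mulr_sumr; apply: big1 => i _.
by rewrite mulrA -(mulgV g) -(fC g) // f0 mulr0 mul0r.
Qed.

End EpsilonStrong.

Theorem theorem3 (G : groupType) (S : nzRingType) (S_ : G -> set S)
    (n : G -> nat) (u v : forall g : G, 'I_(n g) -> S) :
  epsilon_strongly_graded S_ ->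
  epsilon_decomposition S_ u v ->
  (separable_extension (principal S_) <->
   (trace_gamma u v @` center_fin S_) 1).
Proof.
move=> epsS uvP; split; first exact: trace_of_separable.
by move=> [r rf tr1]; exact: (separable_of_trace epsS uvP rf tr1).
Qed.
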